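(* Let $m\ge 2$ and let $p_j\in\mathbb{R}^2$, $j=1,\ldots,m$, be pairwise distinct points. Let $p>1$ be real and $f:\mathbb{R}\times S^1\to\mathbb{R}$, $f(c,n)=\sum_{j=1}^m|c-\langle p_j,n\rangle|^p$. There exists a line with minimal geometric $L^p$-distance to the set $\{p_1,\ldots,p_m\}$. If the line $g=\{q\in\mathbb{R}^2:\langle q,n\rangle=c\}$ with $c\in\mathbb{R}$ and $n\in S^1$ has minimal geometric $L^p$-distance to $\{p_1,\ldots,p_m\}$, then $c$ and $n$ satisfy the equations $$\sum_{j\in J_-}|c-\langle p_j,n\rangle|^{p-1}=\sum_{j\in J_+}|c-\langle p_j,n\rangle|^{p-1}$$ and $$\sum_{j\in J_-}|c-\langle p_j,n\rangle|^{p-1}p_j^TJn=\sum_{j\in J_+}|c-\langle p_j,n\rangle|^{p-1}p_j^TJn.$$ If $n'\in S^1$ and $c_0,c_1\in\mathbb{R}$ satisfy $f(c_0,n')=f(c_1,n')=\min\{f(c,n):c\in\mathbb{R},n\in S^1\}$, then $c_0=c_1$.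
   Context: A line $\{q\in\mathbb{R}^2:\langle q,n\rangle=c\}$ with $c\in\mathbb{R}$, $n\in S^1$ (unit circle, Euclidean inner product) has minimal geometric $L^p$-distance to $\{p_1,\ldots,p_m\}$ if $f$ attains its global minimum over $\mathbb{R}\times S^1$ at $(c,n)$. For given $(c,n)$: $J_+=\{j:\langle p_j,n\rangle>c\}$ and $J_-=\{j:\langle p_j,n\rangle<c\}$. The matrix $J$ is $J=\begin{pmatrix}0&-1\\1&0\end{pmatrix}$. *)

(* Defs.v *)
From mathcomp Require Import all_boot all_order all_algebra.
From mathcomp Require Import all_classical all_reals all_analysis.

Set Implicit Arguments.
Unset Strict Implicit.
Unset Printing Implicit Defensive.

Import Order.TTheory GRing.Theory Num.Theory.

Local Open Scope classical_set_scope.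
Local Open Scope ring_scope.

Section LpLine.
Context {R : realType}.

Definition dot (u v : 'cV[R]_2) : R := (u^T *m v) 0 0.

Definition unit_circle : set 'cV[R]_2 := [set n | dot n n = 1].

Definition line (c : R) (n : 'cV[R]_2) : set 'cV[R]_2 := [set q | dot q n = c].

(* The matrix with rows (0, -1) and (1, 0). *)
Definition rotJ : 'M[R]_2 := delta_mx 1 0 - delta_mx 0 1.

Context {m : nat}.
Variables (p : R) (P : 'I_m -> 'cV[R]_2).

Definition Lp_cost (c : R) (n : 'cV[R]_2) : R :=
  \sum_(j < m) `|c - dot (P j) n| `^ p.

Definition is_min_cost (mu : R) : Prop :=
  let values := [set Lp_cost x.1 x.2 | x in [set: R] `*` unit_circle] in
  values mu /\ lbound values mu.

(* A property of the point set g; a line has exactly the two representations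
   (c, n) and (- c, - n) with a unit normal, and Lp_cost agrees on them. *)
Definition minimal_Lp_line (g : set 'cV[R]_2) : Prop :=
  exists c n, [/\ unit_circle n, g = line c n & is_min_cost (Lp_cost c n)].

Definition Jplus (c : R) (n : 'cV[R]_2) : {set 'I_m} :=
  [set j | c < dot (P j) n]%SET.

Definition Jminus (c : R) (n : 'cV[R]_2) : {set 'I_m} :=
  [set j | dot (P j) n < c]%SET.

End LpLine.

(* Main.v *)
Require Import Defs.
From mathcomp Require Import all_boot all_order all_algebra.
From mathcomp Require Import all_classical all_reals all_analysis.
From mathcomp Require Import ring lra.

Set Implicit Arguments.
Unset Strict Implicit.
Unset Printing Implicit Defensive.

Import Order.TTheory GRing.Theory Num.Theory.
Import numFieldNormedType.Exports.

Local Open Scope classical_set_scope.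
Local Open Scope ring_scope.

(**
The proof is calculus in the two parameters of a line: the offset [c] and the
angle [t] of its normal [(cos t, sin t)].

Existence. For unit normals all the numbers [dot (P j) n] lie in one interval
[[-M, M]], and moving [c] to the nearest point of that interval takes it no
farther from any of them ([nearest_in_itv]), so the cost does not increase. It
is therefore enough to minimize a continuous function over the compact
rectangle [[-M, M] x [-pi, pi]] ([is_min_cost_ex]).

Necessary conditions. For [p > 1] the function [|x|^p] is differentiable even
at 0, with derivative [p * sg x * |x|^(p-1)] ([is_derive_normr_powR]). The cost
is thus differentiable in [c] and in [t], and both partial derivatives vanish
at a minimum ([offset_stationary], [direction_stationary]). The two balance
equations say just this, once the signs of [c - dot (P j) n] are sorted into
[J_-] and [J_+]; the factor [p_j^T J n] is the derivative of [dot (P j) n]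
in the angle, since [J n] is the derivative of the normal. Being minimal is a
property of the point set of the line, so one also needs that two
representations of a line give the same cost ([line_dist]).

Uniqueness of the offset. The first equation says that the sum of the signed
powers [sg x * |x|^(p-1)] at [x = c - dot (P j) n] vanishes; this sum is
strictly increasing in [c], so it has at most one zero
([minimizing_offset_unique]).
*)

(** * The signed power and the derivative of [|x|^p] *)

Section SignedPower.
Context {R : realType}.
Implicit Types a p x y : R.

(** Up to the factor [p], the derivative of [|x|^p] when [a = p - 1]. *)
Definition signed_powR a x : R := Num.sg x * `|x| `^ a.

Lemma gt0_signed_powR a x : 0 < x -> signed_powR a x = x `^ a.
Proof. by move=> x0; rewrite /signed_powR gtr0_sg// mul1r gtr0_norm. Qed.

Lemma signed_powR0 a : signed_powR a 0 = 0.
Proof. by rewrite /signed_powR sgr0 mul0r. Qed.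

Lemma signed_powRN a x : signed_powR a (- x) = - signed_powR a x.
Proof. by rewrite /signed_powR sgrN normrN mulNr. Qed.

Lemma ltr_signed_powR a : 0 < a -> {homo signed_powR a : x y / x < y}.
Proof.
move=> a0.
have pos x y : 0 <= x -> x < y -> signed_powR a x < signed_powR a y.
  rewrite le_eqVlt => /predU1P[<- y0|x0 xy].
    by rewrite signed_powR0 gt0_signed_powR// powR_gt0.
  have y0 : 0 < y by exact: lt_trans xy.
  by rewrite !gt0_signed_powR// gt0_ltr_powR// nnegrE ltW.
move=> x y xy; have [x0|x0] := leP 0 x; first exact: pos.
have [y0|y0] := leP y 0.
  rewrite -[x]opprK -[y]opprK signed_powRN [ltRHS]signed_powRN ltrN2.
  by rewrite pos ?oppr_ge0 ?ltrN2.
apply: (@lt_trans _ _ 0).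
- by rewrite -[x]opprK signed_powRN oppr_lt0 -(signed_powR0 a) pos// oppr_gt0.
- by rewrite -(signed_powR0 a) pos.
Qed.

Lemma signed_powR_continuous0 a : 0 < a -> {for 0, continuous (signed_powR a)}.
Proof.
move=> a0; apply/cvgrPdist_lt => e e0; near=> x; rewrite signed_powR0.
have : `|x| < e `^ a^-1.
  near: x; have := @nbhs0_lt R R (e `^ a^-1) (powR_gt0 _ e0); apply.
move=> /(gt0_ltr_powR a0).
rewrite !nnegrE powR_ge0 normr_ge0 -powRrM mulVf ?gt_eqF// powRr1 ?ltW// => xe.
rewrite sub0r normrN /signed_powR normrM (ger0_norm (powR_ge0 _ _)) normr_sg.
apply: le_lt_trans (xe isT isT); apply: ler_piMl; first exact: powR_ge0.
by case: (x != 0).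
Unshelve. all: by end_near. Qed.

(** Away from 0 this is the derivative of [x^p] and its mirror image. At 0 it is
the factorization [|z|^p = signed_powR (p - 1) z * z], whose first factor is
continuous and vanishes there because [p - 1 > 0]. *)
Lemma is_derive_normr_powR p x : 1 < p ->
  is_derive x 1 (fun z : R => `|z| `^ p) (p * signed_powR (p - 1) x).
Proof.
move=> p1; have p0 : 0 < p by lra.
have pos (z : R) : 0 < z ->
    is_derive z 1 (fun z : R => `|z| `^ p) (p * signed_powR (p - 1) z).
  move=> z0; rewrite gt0_signed_powR//.
  apply: (near_eq_is_derive _ (is_derive1_powR p z0)).
  near=> w; rewrite gtr0_norm//; near: w; exact: lt_nbhsr.
have [x0|x0|->] := ltgtP x 0.
- have xN : 0 < - x by rewrite oppr_gt0.
  have -> : (fun z : R => `|z| `^ p) = (fun z : R => `|z| `^ p) \o -%R.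
    by apply/funext => z /=; rewrite normrN.
  have -> : p * signed_powR (p - 1) x = p * signed_powR (p - 1) (- x) * -1.
    by rewrite signed_powRN mulrN1 mulrN opprK.
  by apply: is_derive1_comp; exact: pos.
- exact: pos.
- apply/is_derive1_caratheodory; exists (signed_powR (p - 1)); split.
  + move=> z; rewrite normr0 powR0 ?gt_eqF// !subr0 /signed_powR mulrAC -normrEsg.
    by rewrite mulr_powRB1.
  + by apply: signed_powR_continuous0; lra.
  + by rewrite signed_powR0 mulr0.
Unshelve. all: by end_near. Qed.

(** Fermat's rule for a sum of [p]-th powers along a curve, stated for arbitrary
residuals [u j] so as to serve both for translating and for rotating a line. *)
Lemma sum_normr_powR_stationary m p (u d : 'I_m -> R -> R) (t0 : R) :
    1 < p -> (forall j (t : R), is_derive t 1 (u j) (d j t)) ->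
    (forall t, \sum_(j < m) `|u j t0| `^ p <= \sum_(j < m) `|u j t| `^ p) ->
  \sum_(j < m) signed_powR (p - 1) (u j t0) * d j t0 = 0.
Proof.
move=> p1 du tmin; pose F := \sum_(j < m) ((fun z : R => `|z| `^ p) \o u j).
have FE t : F t = \sum_(j < m) `|u j t| `^ p by rewrite /F fct_sumE.
have dF (t : R) :
    is_derive t 1 F (\sum_(j < m) p * signed_powR (p - 1) (u j t) * d j t).
  apply: is_derive_sum => j; apply: is_derive1_comp.
  exact: is_derive_normr_powR.
have : is_derive t0 1 F 0.
  apply: (@derive1_at_min _ _ (t0 - 1) (t0 + 1)); first lra.
  - by move=> t _; exact: ex_derive.
  - by rewrite in_itv/=; apply/andP; split; lra.
  - by move=> t _; rewrite !FE.
move=> [_ F0]; have [_] := dF t0; rewrite F0.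
under eq_bigr do rewrite -mulrA.
rewrite -mulr_sumr => /esym/eqP; rewrite mulf_eq0 gt_eqF/=; last lra.
by move/eqP.
Qed.

(** This turns the vanishing of a partial derivative into a balance between the
points on the two sides of the line; points on the line contribute 0. *)
Lemma sum_signed_powR_split m a (y w : 'I_m -> R) c :
  \sum_(j < m) signed_powR a (c - y j) * w j =
    \sum_(j in [set j | y j < c]%SET) `|c - y j| `^ a * w j -
    \sum_(j in [set j | c < y j]%SET) `|c - y j| `^ a * w j.
Proof.
rewrite [X in _ = X - _]big_mkcond [X in _ = _ - X]big_mkcond -sumrB.
apply: eq_bigr => j _; rewrite !inE /signed_powR.
have [yc|yc|->] := ltgtP (y j) c.
- by rewrite gtr0_sg ?subr_gt0// mul1r subr0.
- by rewrite ltr0_sg ?subr_lt0// mulN1r mulNr sub0r.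
- by rewrite !subrr sgr0 !mul0r.
Qed.

End SignedPower.

(** * Unit normals and lines in the plane *)

Section Plane.
Context {R : realType}.
Implicit Types (q n : 'cV[R]_2) (c t : R).

Definition unit_vector t : 'cV[R]_2 := \col_i (if i == 0 then cos t else sin t).

Lemma dotE q n : dot q n = q 0 0 * n 0 0 + q 1 0 * n 1 0.
Proof.
rewrite /dot mxE big_ord_recl big_ord1 !mxE.
by have -> : lift ord0 ord0 = 1 :> 'I_2 by exact/val_inj.
Qed.

Lemma rotJE n : (rotJ *m n) 0 0 = - n 1 0 /\ (rotJ *m n) 1 0 = n 0 0.
Proof.
have lift1 : lift ord0 ord0 = 1 :> 'I_2 by exact/val_inj.
by split; rewrite mxE big_ord_recl big_ord1 !mxE lift1 /= ?subrr ?subr0 ?sub0r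
  ?mul0r ?mul1r ?mulN1r ?add0r ?addr0.
Qed.

Lemma dot_rotJE q n : (q^T *m rotJ *m n) 0 0 = q 1 0 * n 0 0 - q 0 0 * n 1 0.
Proof.
rewrite -mulmxA -[LHS]/(dot q _) dotE; have [-> ->] := rotJE n; ring.
Qed.

Lemma unit_circleE n : unit_circle n -> n 0 0 ^+ 2 + n 1 0 ^+ 2 = 1.
Proof. by rewrite /unit_circle/= dotE -!expr2. Qed.

Lemma dot_unit_vector q t :
  dot q (unit_vector t) = q 0 0 * cos t + q 1 0 * sin t.
Proof. by rewrite dotE !mxE. Qed.

Lemma unit_vector_unit t : unit_circle (unit_vector t).
Proof. by rewrite /unit_circle/= dot_unit_vector !mxE/= -!expr2 cos2Dsin2. Qed.

Lemma unit_circle_polar n : unit_circle n ->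
  exists2 t : R, t \in `[- pi, pi]%R & n = unit_vector t.
Proof.
move=> /unit_circleE n1; set x := n 0 0 in n1; set y := n 1 0 in n1.
have x1 : -1 <= x <= 1 by apply/andP; split; nra.
have cx : cos (acos x) = x by rewrite acosK.
have sx : sin (acos x) = `|y|.
  by rewrite sin_acos// -sqrtr_sqr; congr Num.sqrt; lra.
have a0 := acos_ge0 x1; have api := acos_lepi x1; have pi0 := pi_ge0 R.
have eqn t : cos t = x -> sin t = y -> n = unit_vector t.
  move=> ct st; apply/matrixP => i j; rewrite (ord1 j) mxE.
  case: eqP => [->|/eqP i0]; first by rewrite ct.
  rewrite st; congr (n _ _); apply/val_inj => /=.
  by case: i i0 => -[|[|]].
have [y0|y0] := leP 0 y.
- exists (acos x); first by rewrite in_itv/=; apply/andP; split; lra.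
  by apply: eqn; rewrite // sx ger0_norm.
- exists (- acos x); first by rewrite in_itv/=; apply/andP; split; lra.
  by apply: eqn; rewrite ?cosN// sinN sx ltr0_norm// opprK.
Qed.

(** Both sides are the distance from [q] to the line. That the points [c *: n] and
[c *: n + rotJ *m n] of the first line lie on the second forces [n' = s *: n]
and [c' = s * c] with [s = dot n n'], and then [|s| = 1]. *)
Lemma line_dist c c' n n' q : unit_circle n -> unit_circle n' ->
  line c n = line c' n' -> `|c - dot q n| = `|c' - dot q n'|.
Proof.
move=> /unit_circleE n1 /unit_circleE n1' ln; have [J0 J1] := rotJE n.
have dotL a u v : dot (a *: n + u) v = a * dot n v + dot u v.
  by rewrite /dot linearP/= mulmxDl -scalemxAl !mxE.
have dot0 v : dot 0 v = 0 by rewrite /dot linear0 mul0mx mxE.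
(* The summand 0 lets [dotL] handle both points alike. *)
have : line c' n' (c *: n + 0) /\ line c' n' (c *: n + rotJ *m n).
  rewrite -ln /line/= !dotL !dot0 !dotE J0 J1.
  by split; rewrite -[RHS]mulr1 -n1; ring.
rewrite /line/= !dotL !dot0 !dotE J0 J1 addr0.
set x := n 0 0 in n1 *; set y := n 1 0 in n1 *.
set x' := n' 0 0 in n1' *; set y' := n' 1 0 in n1' * => -[foot along].
have par : x * y' = y * x' by lra.
pose s := x * x' + y * y'.
have sx : x' = s * x by rewrite -[LHS]mul1r -n1 /s; ring: par.
have sy : y' = s * y by rewrite -[LHS]mul1r -n1 /s; ring: par.
have s1 : `|s| = 1.
  apply/eqP; rewrite -(@eqrXn2 _ 2)// expr1n real_normK ?num_real//.
  by rewrite -[X in X == _]mulr1 -n1 mulrDr -!exprMn -sx -sy n1' n1.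
have -> : c' - (q 0 0 * x' + q 1 0 * y') = s * (c - (q 0 0 * x + q 1 0 * y)).
  by rewrite -foot -/s sx sy; ring.
by rewrite normrM s1 mul1r.
Qed.

(** Projecting the offset onto [[-M, M]] does not increase any residual, which
makes the minimization a problem on a compact set. *)
Lemma nearest_in_itv M c : 0 <= M -> exists2 c' : R, c' \in `[- M, M]%R &
  forall a : R, `|a| <= M -> `|c' - a| <= `|c - a|.
Proof.
move=> M0; have [cM|cM] := leP `|c| M.
  by exists c => //; rewrite in_itv/= -ler_norml.
have [c0|c0] := leP 0 c.
- exists M; first by rewrite in_itv/= lexx andbT; lra.
  move=> a; rewrite ler_norml => /andP[a1 a2].
  by rewrite !ger0_norm; move: cM; rewrite ger0_norm//; lra.
- exists (- M); first by rewrite in_itv/= lexx /=; lra.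
  move=> a; rewrite ler_norml => /andP[a1 a2].
  by rewrite !ler0_norm; move: cM; rewrite ltr0_norm//; lra.
Qed.

(** Rotating the normal: its derivative in the angle is [rotJ] applied to it. *)
Lemma is_derive_signed_dist c q t :
  is_derive t 1 (fun s : R => c - dot q (unit_vector s))
    (- (q^T *m rotJ *m unit_vector t) 0 0).
Proof.
have -> : (fun s : R => c - dot q (unit_vector s)) =
    cst c - (q 0 0 *: (@cos R) + q 1 0 *: (@sin R)).
  by apply/funext => s; rewrite dot_unit_vector.
apply: is_derive_eq; rewrite dot_rotJE !mxE/= /GRing.scale/=; ring.
Qed.

End Plane.

(** * Minimizers of the cost *)

Section Minimizers.
Context {R : realType} {m : nat}.
Context (P : 'I_m -> 'cV[R]_2) (p : R).

Lemma Lp_cost_min c n c' n' : is_min_cost p P (Lp_cost p P c n) ->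
  unit_circle n' -> Lp_cost p P c n <= Lp_cost p P c' n'.
Proof. by move=> [_ +] n1; apply; exists (c', n'). Qed.

Lemma Lp_cost_continuous : 1 < p ->
  continuous (fun x : R * R => Lp_cost p P x.1 (unit_vector x.2)).
Proof.
move=> p1 x; apply: cvg_big; first exact: add_continuous.
move=> j _.
apply: (@continuous_comp _ _ _ (fun z => z.1 - dot (P j) (unit_vector z.2))
  (fun z : R => `|z| `^ p)).
- apply: cvgB; first exact: cvg_fst.
  apply: (cvg_comp _ (fun t : R => dot (P j) (unit_vector t)) cvg_snd).
  have -> : (fun t : R => dot (P j) (unit_vector t)) =
      (fun t => P j 0 0 * cos t + P j 1 0 * sin t).
    by apply/funext => t; rewrite dot_unit_vector.
  rewrite dot_unit_vector.
  apply: cvgD; apply: cvgMr; [exact: continuous_cos|exact: continuous_sin].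
- have [d _] := is_derive_normr_powR (x.1 - dot (P j) (unit_vector x.2)) p1.
  by have /differentiable_continuous := (derivable1_diffP _ _).1 d.
Qed.

Lemma is_min_cost_ex : 1 < p ->
  exists c n, unit_circle n /\ is_min_cost p P (Lp_cost p P c n).
Proof.
move=> p1.
pose M := \sum_(j < m) (`|P j 0 0| + `|P j 1 0|).
have M0 : 0 <= M by apply: sumr_ge0 => j _; exact: addr_ge0.
have dotM j t : `|dot (P j) (unit_vector t)| <= M.
  apply: (@le_trans _ _ (`|P j 0 0| + `|P j 1 0|)).
    rewrite dot_unit_vector (le_trans (ler_normD _ _))// lerD// normrM ler_piMr//.
      by rewrite ler_norml cos_geN1 cos_le1.
    by rewrite ler_norml sin_geN1 sin_le1.
  by rewrite /M (bigD1 j)//= lerDl; apply: sumr_ge0 => i _; exact: addr_ge0.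
pose A : set (R * R) := `[- M, M]%classic `*` `[- pi, pi]%classic.
have A0 : A !=set0.
  by exists (0, 0); split; rewrite /= in_itv/= ?oppr_le0 ?pi_ge0 ?M0.
have cA : compact A by apply: compact_setX; exact: segment_compact.
have [[c t] _ minc] := compact_EVT_min A0 cA
  (continuous_subspaceT (Lp_cost_continuous p1)).
exists c, (unit_vector t); split; first exact: unit_vector_unit.
split; first by exists (c, unit_vector t) => //; split=> //; exact: unit_vector_unit.
move=> _ [[c' n'] [_ /= /unit_circle_polar [t' t'pi ->]] <-].
have [c'' c''M cl] := nearest_in_itv c' M0.
apply: (le_trans (minc (c'', t') _)); first by rewrite inE; split.
apply: ler_sum => j _; apply: ge0_ler_powR; rewrite ?nnegrE//.
  exact: ltW (lt_trans ltr01 p1).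
exact: cl.
Qed.

Lemma offset_stationary c n : 1 < p -> unit_circle n ->
  is_min_cost p P (Lp_cost p P c n) ->
  \sum_(j < m) signed_powR (p - 1) (c - dot (P j) n) = 0.
Proof.
move=> p1 n1 cmin.
under eq_bigr do rewrite -[signed_powR _ _]mulr1.
apply: (@sum_normr_powR_stationary R m p (fun j x => x - dot (P j) n)
  (fun _ _ => 1) c p1).
- by move=> j t; apply: is_derive_eq; rewrite subr0.
- by move=> t; exact: Lp_cost_min.
Qed.

Lemma direction_stationary c n : 1 < p -> unit_circle n ->
  is_min_cost p P (Lp_cost p P c n) ->
  \sum_(j < m) signed_powR (p - 1) (c - dot (P j) n) *
    ((P j)^T *m rotJ *m n) 0 0 = 0.
Proof.
move=> p1 /unit_circle_polar[t _ ->] cmin; apply: oppr_inj.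
rewrite oppr0 -sumrN; under eq_bigr do rewrite -mulrN.
apply: (@sum_normr_powR_stationary R m p
  (fun j s => c - dot (P j) (unit_vector s))
  (fun j s => - ((P j)^T *m rotJ *m unit_vector s) 0 0) t p1).
- by move=> j s; exact: is_derive_signed_dist.
- by move=> s; apply: Lp_cost_min => //; exact: unit_vector_unit.
Qed.

(** The sum in [offset_stationary] is strictly increasing in the offset as soon
as there is a point, so it cannot vanish at two offsets. *)
Lemma minimizing_offset_unique n c0 c1 : 1 < p -> (0 < m)%N -> unit_circle n ->
  is_min_cost p P (Lp_cost p P c0 n) -> is_min_cost p P (Lp_cost p P c1 n) ->
  c0 = c1.
Proof.
move=> p1 m0 n1; wlog c01 : c0 c1 / c0 < c1.
  move=> H min0 min1; have [h|h|//] := ltgtP c0 c1; first exact: H.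
  by apply/esym/H.
move=> /(offset_stationary p1 n1) s0 /(offset_stationary p1 n1) s1.
suff : \sum_(j < m) signed_powR (p - 1) (c0 - dot (P j) n) <
       \sum_(j < m) signed_powR (p - 1) (c1 - dot (P j) n) by rewrite s0 s1 ltxx.
apply: ltr_sum; first by rewrite has_predT /index_enum -enumT size_enum_ord.
by move=> j _; apply: ltr_signed_powR; [rewrite subr_gt0|rewrite ltrD2r].
Qed.

Lemma minimal_Lp_line_min_cost c n : unit_circle n ->
  minimal_Lp_line p P (line c n) -> is_min_cost p P (Lp_cost p P c n).
Proof.
move=> n1 [c' [n' [n1' ln]]]; suff -> : Lp_cost p P c' n' = Lp_cost p P c n by [].
by apply: eq_bigr => j _; rewrite (line_dist (P j) n1 n1' ln).
Qed.

End Minimizers.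

Theorem theorem9 (R : realType) (m : nat) (hm : (2 <= m)%N)
    (P : 'I_m -> 'cV[R]_2) (hP : injective P) (p : R) (hp : 1 < p) :
  [/\ exists g : set 'cV[R]_2, minimal_Lp_line p P g,
      forall (c : R) (n : 'cV[R]_2), unit_circle n ->
        minimal_Lp_line p P (line c n) ->
        \sum_(j in Jminus P c n) `|c - dot (P j) n| `^ (p - 1) =
          \sum_(j in Jplus P c n) `|c - dot (P j) n| `^ (p - 1)
        /\
        \sum_(j in Jminus P c n)
            `|c - dot (P j) n| `^ (p - 1) * ((P j)^T *m rotJ *m n) 0 0 =
          \sum_(j in Jplus P c n)
            `|c - dot (P j) n| `^ (p - 1) * ((P j)^T *m rotJ *m n) 0 0
    & forall (n' : 'cV[R]_2) (c0 c1 mu : R), unit_circle n' ->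
        is_min_cost p P mu -> Lp_cost p P c0 n' = mu ->
        Lp_cost p P c1 n' = mu -> c0 = c1].
Proof.
split.
- have [c [n [n1 cmin]]] := is_min_cost_ex P hp.
  by exists (line c n), c, n.
- move=> c n n1 /(minimal_Lp_line_min_cost n1) cmin; split.
  + have := offset_stationary hp n1 cmin.
    under eq_bigr do rewrite -[signed_powR _ _]mulr1.
    rewrite sum_signed_powR_split => /subr0_eq.
    by under eq_bigr do rewrite mulr1; under [RHS]eq_bigr do rewrite mulr1.
  + have := direction_stationary hp n1 cmin.
    by rewrite sum_signed_powR_split; exact: subr0_eq.
- move=> n c0 c1 mu n1 mumin E0 E1.
  have m0 : (0 < m)%N by exact: leq_trans hm.
  by apply: (minimizing_offset_unique (P := P) hp m0 n1);
    rewrite ?E0 ?E1.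
Qed.
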